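(* Let $k$ be a field of characteristic $0$, let $S$ be a simple extension of $k$ of degree $n$, and let $c$ be a primitive element of $S/k$. Let $q$ be a regular quadratic form over $k$ of rank $m$ and let $x=(x^{(1)},\dots,x^{(m)})\in S^m$ satisfy $q(x)\neq 0$. Let $V_c=\{b\in S^*\mid cb^2\text{ is a primitive element of }S/k\}$. Then the set $$U_{c,x,q}=\{b\in V_c\mid q(\{xb^{-1},cb^2\})\neq 0\}$$ is non-empty and open in $S^*$, where for $b\in V_c$ we write $\{xb^{-1},cb^2\}=(\{x^{(1)}b^{-1},cb^2\},\dots,\{x^{(m)}b^{-1},cb^2\})\in k^m$.
   Context: A $k$-algebra $S$ is a simple extension of degree $n$ of the field $k$ if there is $c\in S^*$ (a primitive element) such that $1,c,\dots,c^{n-1}$ is a $k$-basis of $S$. For a primitive element $d$ and $y\in S$, $\{y,d\}$ denotes the coefficient $y_{n-1}$ in the unique expression $y=\sum_{i=0}^{n-1}y_i d^i$ with $y_i\in k$. $S$ is identified with $\mathbb{A}^n(k)$ via a $k$-basis and given the Zariski topology; $S^*$ carries the subspace topology. *)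

(* Defs.v *)
From HB Require Import structures.
From mathcomp Require Import all_boot all_order all_algebra all_field.
From mathcomp Require Import mpoly.
Set Implicit Arguments. Unset Strict Implicit. Unset Printing Implicit Defensive.
Import GRing.Theory.
Local Open Scope ring_scope.

(* S is a finite-dimensional (unital) k-algebra; it is a simple extension of
   degree n as soon as it has a primitive element of degree n. *)

Definition primitive_elt (k : fieldType) (S : falgType k) (n : nat) (c : S) :=
  (c \is a GRing.unit) /\ basis_of fullv (mkseq (fun i => c ^+ i) n).

(* {y, d}: the coefficient y_(n-1) in y = \sum_(i<n) y_i d^i.
   (indexed over n.-1.+1 = n, since n >= 1 for any simple extension) *)
Definition brace (k : fieldType) (S : falgType k) (n : nat) (y d : S) : k :=
  coord [tuple d ^+ (val i) | i < n.-1.+1] ord_max y.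

Definition coords (k : fieldType) (S : falgType k) (s : S) : 'I_(\dim {: S}) -> k :=
  fun i => coord (vbasis fullv) i s.

Definition zariski_closed (k : fieldType) (S : falgType k) (Z : S -> Prop) :=
  exists P : {mpoly k[\dim {: S}]} -> Prop,
    forall s, Z s <-> (forall p, P p -> p.@[coords s] = 0).

Definition open_in_units (k : fieldType) (S : falgType k) (U : S -> Prop) :=
  (forall b, U b -> b \is a GRing.unit) /\
  exists Z, zariski_closed Z /\
    forall b, b \is a GRing.unit -> (U b <-> ~ Z b).

Definition regular_qform (k : fieldType) (m : nat) (A : 'M[k]_m) :=
  A^T = A /\ A \in unitmx.

Definition qform (k : fieldType) (m : nat) (A : 'M[k]_m) (y : 'I_m -> k) : k :=
  \sum_(i < m) \sum_(j < m) A i j * y i * y j.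

Definition qformS (k : fieldType) (S : falgType k) (m : nat) (A : 'M[k]_m)
  (x : 'I_m -> S) : S :=
  \sum_(i < m) \sum_(j < m) A i j *: (x i * x j).

Definition Vset (k : fieldType) (S : falgType k) (n : nat) (c : S) (b : S) :=
  b \is a GRing.unit /\ primitive_elt n (c * b ^+ 2).

Definition Uset (k : fieldType) (S : falgType k) (n : nat) (c : S) (m : nat)
  (A : 'M[k]_m) (x : 'I_m -> S) (b : S) :=
  Vset n c b /\ qform A (fun i => brace n (x i * b^-1) (c * b ^+ 2)) <> 0.

(* Main.v *)
(* Write d = c b^2 and let E(b) be the matrix whose rows are the coordinates of
   b d^i = c^i b^(2i+1), i < n, in the basis of powers of c. By Cramer's rule,
   det E(b) {y/b, d} = sum_j y_j psi_j(b), where psi(b) is the last column of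
   the adjugate of E(b); moreover det E(b) <> 0 iff d is primitive. So U is the
   nonvanishing locus in the units of S of a polynomial in b, namely
   det E(b) * q(sum_j x_j psi_j(b)), where x_j in k^m are the components of x.

   For nonemptiness, expand psi(1 + s beta) in powers of s. Differentiating the
   relations E(b) psi(b) = (0, ..., 0, det E(b)) shows that the linear term is
   -(2i+1) {c^i beta, c} in position i < n-1. As 2i+1 <> 0 in k and the form
   (y, z) |-> {yz, c} is nondegenerate, this tangent vector is arbitrary modulo
   psi(1). If q(sum_j x_j psi_j) vanished identically, the terms of order at
   most 2 in s would force the span of the x_j to be totally isotropic, whence
   q(x) = 0. *)
Require Import Defs.
From HB Require Import structures.
From mathcomp Require Import all_boot all_order all_algebra all_field.
From mathcomp Require Import mpoly.
From Stdlib Require Import Classical_Prop.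
Set Implicit Arguments. Unset Strict Implicit. Unset Printing Implicit Defensive.
Import GRing.Theory.
Local Open Scope ring_scope.

(** In characteristic 0 the integers below [size p] have distinct images in [k], too many for all of
    them to be roots of [p]. *)
Lemma pchar0_poly_nonroot (k : fieldType) (p : {poly k}) :
  [pchar k] =i pred0 -> p != 0 -> exists s, p.[s] != 0.
Proof.
move=> /pcharf0P k0 p0.
pose rs : seq k := [seq i%:R | i <- iota 0 (size p)].
have rs_uniq : uniq rs.
  rewrite map_inj_uniq ?iota_uniq // => i j.
  wlog le_ij : i j / (i <= j)%N.
    by move=> wl; case/orP: (leq_total i j) => h eq; [|symmetry]; apply: wl.
  move=> /eqP; rewrite eq_sym -subr_eq0 -natrB // k0 subn_eq0 => le_ji.
  by apply/eqP; rewrite eqn_leq le_ij.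
have /allPn[s _ ps] : ~~ all (root p) rs.
  by apply/negP => /(max_poly_roots p0)/(_ rs_uniq); rewrite size_map size_iota ltnn.
by exists s.
Qed.

Lemma fullv_basis_sum (k : fieldType) (V : vectType k) (n : nat)
    (e : n.-tuple V) (y : V) :
  basis_of fullv e -> y = \sum_i coord e i y *: e`_i.
Proof. by move=> /coord_basis eb; apply: eb (memvf y). Qed.

Lemma coord_inj (k : fieldType) (V : vectType k) (n : nat) (e : n.-tuple V) (y z : V) :
  basis_of fullv e -> (forall j, coord e j y = coord e j z) -> y = z.
Proof.
move=> eb yz; rewrite (fullv_basis_sum y eb) (fullv_basis_sum z eb).
by apply: eq_bigr => j _; rewrite yz.
Qed.

(** * Polynomial dependence of coordinates on [b] *)

Section PolynomialCoordinates.
Variables (k : fieldType) (S : falgType k).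

Lemma mul_exp_coords_mpoly (y : S) (r : nat) :
  {P : 'I_(\dim {: S}) -> {mpoly k[\dim {: S}]} |
    forall b l, (P l).@[coords b] = coords (y * b ^+ r) l}.
Proof.
elim: r => [|r [P Pb]].
  by exists (fun l => (coords y l)%:MP) => b l; rewrite mevalC expr0 mulr1.
pose v := vbasis {: S}.
exists (fun l => \sum_i \sum_j (P i * 'X_j) * (coords (v`_i * v`_j) l)%:MP) => b l.
have sumv z := fullv_basis_sum z (vbasisP {: S}).
have -> : y * b ^+ r.+1 = (\sum_i coords (y * b ^+ r) i *: v`_i) *
    (\sum_j coords b j *: v`_j) by rewrite -!sumv exprSr mulrA.
rewrite /coords mulr_suml !linear_sum /=.
apply: eq_bigr => i _; rewrite mulr_sumr !linear_sum /=.
apply: eq_bigr => j _.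
by rewrite !mevalM Pb mevalXU mevalC -scalerAl -scalerAr !linearZ /= mulrA.
Qed.

Lemma mul_exp_coord_mpoly (n : nat) (e : n.-tuple S) (j : 'I_n) (y : S) (r : nat) :
  {p : {mpoly k[\dim {: S}]} |
    forall b, p.@[coords b] = coord e j (y * b ^+ r)}.
Proof.
have [P Pb] := mul_exp_coords_mpoly y r.
exists (\sum_i P i * (coord e j (vbasis {: S})`_i)%:MP) => b.
rewrite [X in coord e j X](fullv_basis_sum _ (vbasisP {: S})) !linear_sum /=.
by apply: eq_bigr => i _; rewrite mevalM mevalC Pb linearZ.
Qed.

End PolynomialCoordinates.

(** * Powers of a primitive element and Cramer's rule *)

Section SimpleExtension.
Variables (k : fieldType) (S : falgType k) (n : nat) (c : S).

Definition pow_tuple (d : S) : n.+1.-tuple S := [tuple d ^+ val i | i < n.+1].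

Lemma pow_tuple_nth d (i : 'I_n.+1) : (pow_tuple d)`_i = d ^+ i.
Proof. by rewrite -tnth_nth tnth_mktuple. Qed.

Lemma primitive_eltP d :
  primitive_elt n.+1 d <-> d \is a GRing.unit /\ basis_of fullv (pow_tuple d).
Proof.
rewrite /primitive_elt; suff -> : mkseq (fun i => d ^+ i) n.+1 = pow_tuple d by [].
by rewrite /mkseq -val_enum_ord -map_comp.
Qed.

Hypothesis c_unit : c \is a GRing.unit.
Hypothesis c_basis : basis_of fullv (pow_tuple c).

Local Notation e := (pow_tuple c).

Lemma pow_sum y : y = \sum_(i < n.+1) coord e i y *: c ^+ i.
Proof.
rewrite {1}(fullv_basis_sum y c_basis).
by apply: eq_bigr => i _; rewrite pow_tuple_nth.
Qed.

Lemma coord_pow (i j : 'I_n.+1) : coord e j (c ^+ i) = (i == j)%:R.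
Proof. by rewrite -pow_tuple_nth coord_free // (basis_free c_basis). Qed.

(** An [falgType] may be noncommutative, but here the powers of [c], which commute, span [S]. *)
Lemma simple_mulC (y z : S) : y * z = z * y.
Proof.
rewrite (pow_sum y) (pow_sum z) mulr_suml mulr_sumr; apply: eq_bigr => i _.
rewrite mulr_suml mulr_sumr; apply: eq_bigr => j _.
by rewrite -!scalerAl -!scalerAr -!exprD addnC scalerA mulrC -scalerA.
Qed.

(** This is E(b). The factor [b] in each row clears the inverse in [y / b], so that the entries stay
    polynomial in [b]. *)
Definition twisted_mx (b : S) : 'M[k]_n.+1 :=
  \matrix_(i, j) coord e j (c ^+ i * b ^+ i.*2.+1).

Lemma twisted_vecE b (i : nat) : c ^+ i * b ^+ i.*2.+1 = (c * b ^+ 2) ^+ i * b.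
Proof.
rewrite exprMn_comm; last exact: simple_mulC.
by rewrite -exprM mul2n exprSr mulrA.
Qed.

Lemma coord_twisted_sum b (a : 'rV[k]_n.+1) j :
  coord e j ((\sum_i a 0 i *: (c * b ^+ 2) ^+ i) * b) = (a *m twisted_mx b) 0 j.
Proof.
rewrite mulr_suml linear_sum mxE; apply: eq_bigr => i _ /=.
by rewrite -scalerAl linearZ /= -twisted_vecE mxE.
Qed.

Lemma twisted_unit_sum b y : twisted_mx b \in unitmx ->
  y = (\sum_i ((\row_j coord e j y) *m invmx (twisted_mx b)) 0 i
         *: (c * b ^+ 2) ^+ i) * b.
Proof.
move=> Mu; apply: (coord_inj c_basis) => j.
by rewrite coord_twisted_sum mulmxKV // mxE.
Qed.

(** The rows then span [S], so 1 is a multiple of [b]. *)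
Lemma twisted_unit b : twisted_mx b \in unitmx -> b \is a GRing.unit.
Proof.
move=> /(twisted_unit_sum 1); set z := \sum_i _ => zb.
by apply/unitrP; exists z; rewrite (simple_mulC b) -zb.
Qed.

Lemma Vset_twisted b : b \is a GRing.unit ->
  Vset n.+1 c b <-> twisted_mx b \in unitmx.
Proof.
move=> bu; split=> [[_ /primitive_eltP[_ db]]|Mu].
  (* Row [j] of [K] writes [c ^+ j / b] in powers of [c * b ^+ 2]; the factor [b] in [twisted_mx b]
     turns this back into [c ^+ j]. *)
  pose K : 'M_n.+1 := \matrix_(j, i) coord (pow_tuple (c * b ^+ 2)) i (c ^+ j / b).
  suff /mulmx1_unit[] : K *m twisted_mx b = 1%:M by [].
  apply/row_matrixP=> j; apply/rowP => l.
  rewrite row_mul -coord_twisted_sum.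
  rewrite (_ : \sum_i _ = c ^+ j / b) ?divrK ?coord_pow ?mxE //.
  rewrite [RHS](fullv_basis_sum _ db); apply: eq_bigr => i _.
  by rewrite pow_tuple_nth !mxE.
split=> //; apply/primitive_eltP; split; first by rewrite unitrMl ?unitrX.
rewrite basisEdim; apply/andP; split.
  apply/subvP => y _; have := twisted_unit_sum (y * b) Mu; move/(mulIr bu) => ->.
  apply: memv_suml => i _; apply: memvZ; rewrite -pow_tuple_nth.
  by apply/memv_span/mem_nth; rewrite size_tuple.
by rewrite size_tuple -(span_basis c_basis) (eqP (basis_free c_basis)) size_tuple.
Qed.

Definition twisted_cof (b : S) (j : 'I_n.+1) : k := \adj (twisted_mx b) j ord_max.

Lemma brace_twisted b y : b \is a GRing.unit -> Vset n.+1 c b ->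
  \det (twisted_mx b) * brace n.+1 (y / b) (c * b ^+ 2)
    = \sum_j coord e j y * twisted_cof b j.
Proof.
move=> bu [_ /primitive_eltP[_ db]].
pose a : 'rV_n.+1 := \row_i coord (pow_tuple (c * b ^+ 2)) i (y / b).
have ya : y = (\sum_i a 0 i *: (c * b ^+ 2) ^+ i) * b.
  rewrite (_ : \sum_i _ = y / b) ?divrK //.
  rewrite [RHS](fullv_basis_sum _ db); apply: eq_bigr => i _.
  by rewrite pow_tuple_nth !mxE.
transitivity ((a *m twisted_mx b *m \adj (twisted_mx b)) 0 ord_max).
  by rewrite -mulmxA mul_mx_adj mul_mx_scalar !mxE.
by rewrite mxE; apply: eq_bigr => j _; rewrite -coord_twisted_sum -ya.
Qed.

(** * Restriction of E and its cofactors to the lines [1 + s *: beta] *)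

Definition line_mx (beta : S) : 'M[{poly k}]_n.+1 :=
  \matrix_(i, j) \poly_(l < i.*2.+2)
    (coord e j (c ^+ i * beta ^+ l) *+ 'C(i.*2.+1, l)).

Lemma line_mx_eval beta s :
  map_mx (horner_eval s) (line_mx beta) = twisted_mx (1 + s *: beta).
Proof.
apply/matrixP => i j; rewrite !mxE /horner_eval horner_poly.
rewrite exprDn_comm; last exact: simple_mulC.
rewrite mulr_sumr linear_sum; apply: eq_bigr => l _ /=.
rewrite expr1n mul1r exprZn mulrnAr -scalerAr raddfMn /= linearZ /=.
by rewrite mulrnAl mulrC.
Qed.

Definition line_cof beta (j : 'I_n.+1) : {poly k} := \adj (line_mx beta) j ord_max.

Lemma line_cof_eval beta s j :
  (line_cof beta j).[s] = twisted_cof (1 + s *: beta) j.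
Proof.
by rewrite /twisted_cof -line_mx_eval -map_mx_adj mxE.
Qed.

Lemma twisted_mx1 : twisted_mx 1 = 1%:M.
Proof. by apply/matrixP => i j; rewrite !mxE expr1n mulr1 coord_pow. Qed.

Lemma line_cof_coef0 beta j : (line_cof beta j)`_0 = (j == ord_max)%:R.
Proof.
rewrite -horner_coef0 line_cof_eval scale0r addr0 /twisted_cof twisted_mx1.
by have := mul_mx_adj (1%:M : 'M[k]_n.+1); rewrite mul1mx det1 => ->; rewrite mxE.
Qed.

(** Off-diagonal entries of E adj(E) vanish. In the coefficient of s of entry [(i, ord_max)] only
    two terms survive, because E and its adjugate are the identity at s = 0. *)
Lemma line_cof_coef1 beta (i : 'I_n.+1) : i != ord_max ->
  (line_cof beta i)`_1 = - (coord e ord_max (c ^+ i * beta) *+ i.*2.+1).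
Proof.
move=> imax; apply/eqP; rewrite -addr_eq0; apply/eqP.
have /matrixP/(_ i ord_max) := mul_mx_adj (line_mx beta).
rewrite [RHS]mxE (negPf imax) mulr0n mxE => /(congr1 (fun p : {poly k} => p`_1)).
rewrite coef0 coef_sum => h; rewrite -[RHS]h.
under [RHS]eq_bigr => j _.
  rewrite coefM big_ord_recl big_ord1 /= -/(line_cof beta j) line_cof_coef0.
  rewrite mxE !coef_poly /= !expr0 mulr1 bin0 mulr1n coord_pow bin1 /bump /=.
  over.
rewrite big_split /= (bigD1 i) //= eqxx subn0 addn0 expr1 mul1r big1 ?addr0.
  rewrite (bigD1 ord_max) //= eqxx mulr1 big1 ?addr0 //.
  by move=> j /negPf->; rewrite mulr0.
by move=> j; rewrite eq_sym => /negPf->; rewrite mul0r.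
Qed.

(* The Frobenius form (y, z) |-> {yz, c} is nondegenerate: its matrix in the
   basis of powers of c is antitriangular with ones on the antidiagonal. *)
Lemma brace_form_surj (t : 'I_n.+1 -> k) :
  exists beta, forall i : 'I_n.+1, coord e ord_max (c ^+ i * beta) = t i.
Proof.
pose H : 'M[k]_n.+1 := \matrix_(l, i) coord e ord_max (c ^+ i * c ^+ l).
have Hu : H \in unitmx.
  rewrite -row_free_unit -kermx_eq0; apply/rowV0P => u /sub_kermxP uH.
  apply/eqP; apply: contraT => /rV0Pn[l0 ul0].
  case: (@arg_maxnP _ l0 (fun l => u 0 l != 0) (fun l => val l) ul0) => l ul lmax.
  (* Column [n - l] isolates [u 0 l]: larger indices have zero entries in [u] by maximality, and
     smaller ones give powers of [c] below [n]. *)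
  have /rowP/(_ (rev_ord l)) := uH.
  rewrite mxE mxE (bigD1 l) //= mxE -exprD /= subSS subnK ?leq_ord //.
  rewrite (coord_pow ord_max) eqxx mulr1 big1 ?addr0 => [u0|i il].
    by rewrite u0 eqxx in ul.
  have [->|ui] := eqVneq (u 0 i) 0; first by rewrite mul0r.
  have lt_il : (i < l)%N by rewrite ltn_neqAle il; apply: lmax.
  have lt_n : (n - l + i < n)%N.
    by rewrite -[X in (_ < X)%N](subnK (leq_ord l)) ltn_add2l.
  rewrite mxE -exprD /= subSS (coord_pow (Ordinal (leqW lt_n))).
  by rewrite -val_eqE /= (ltn_eqF lt_n) mulr0.
exists (\sum_l ((\row_i t i) *m invmx H) 0 l *: c ^+ l) => i.
transitivity (((\row_i t i) *m invmx H *m H) 0 i); last by rewrite mulmxKV // mxE.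
rewrite mulr_sumr linear_sum [RHS]mxE; apply: eq_bigr => l _ /=.
by rewrite -scalerAr linearZ /= [H l i]mxE.
Qed.

(* At s = 0 the curve s |-> line_cof beta starts at the last basis vector e_n,
   and by brace_form_surj its tangent is arbitrary modulo e_n. Hence the
   coefficients of 1 and s put e_n in the radical of C, and then the
   coefficient of s^2 makes every vector isotropic. *)
Lemma isotropic_lines_eq0 (C : 'M[k]_n.+1) :
  [pchar k] =i pred0 -> C^T = C ->
  (forall beta,
     \sum_i \sum_j (C i j)%:P * line_cof beta i * line_cof beta j = 0) ->
  C = 0.
Proof.
move=> /pcharf0P k0 Csym Ciso.
pose p beta a : 'rV[k]_n.+1 := \row_j (line_cof beta j)`_a.
pose B (u v : 'rV[k]_n.+1) := (u *m C *m v^T) 0 0.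
have Bsym u v : B u v = B v u.
  transitivity ((u *m C *m v^T)^T 0 0); first by rewrite [RHS]mxE.
  by rewrite !trmx_mul trmxK Csym mulmxA.
have BDl u v w : B (u + v) w = B u w + B v w by rewrite /B !mulmxDl mxE.
have BDr u v w : B w (u + v) = B w u + B w v by rewrite !(Bsym w) BDl.
have BZl a u w : B (a *: u) w = a * B u w by rewrite /B -!scalemxAl mxE.
have Bdelta i j : B (delta_mx 0 i) (delta_mx 0 j) = C i j.
  by rewrite /B -rowE trmx_delta -colE !mxE.
pose dM : 'rV[k]_n.+1 := delta_mx 0 ord_max.
have p0 beta : p beta 0%N = dM.
  by apply/rowP => j; rewrite !mxE line_cof_coef0 eqxx.
have p1 w : exists beta a, p beta 1%N = w + a *: dM.
  (* The divisor cancels the factor 2i+1 of [line_cof_coef1]; the last entry is not prescribed, and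
     [a] absorbs it. *)
  have [beta Hb] := brace_form_surj (fun i => - w 0 i / i.*2.+1%:R).
  exists beta, ((line_cof beta ord_max)`_1 - w 0 ord_max).
  apply/rowP => i; rewrite !mxE eqxx /=; have [->|iM] := eqVneq i ord_max.
    by rewrite mulr1 addrC subrK.
  by rewrite mulr0 addr0 line_cof_coef1 // Hb -mulr_natr divfK ?opprK ?k0.
(* This is the coefficient of s^t in [Ciso]; only t = 0, 1, 2 are used. *)
have coefB beta t : \sum_(a < t.+1) B (p beta a) (p beta (t - a)%N) = 0.
  have /(congr1 (fun q : {poly k} => q`_t)) := Ciso beta; rewrite coef0 => h; rewrite -[RHS]h.
  rewrite coef_sum; under [RHS]eq_bigr => i _.
    rewrite coef_sum; under eq_bigr => j _ do
      rewrite -mulrA coefCM coefM mulr_sumr.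
    rewrite exchange_big; over.
  rewrite /= exchange_big /=; apply: eq_bigr => a _.
  rewrite /B -mulmxA mxE; apply: eq_bigr => i _.
  rewrite [(_ *m _) _ _]mxE mulr_sumr; apply: eq_bigr => j _.
  by rewrite !mxE mulrCA.
have two0 (y : k) : y + y = 0 -> y = 0.
  by move/eqP; rewrite -mulr2n -mulr_natr mulf_eq0 k0 orbF => /eqP.
have BMM : B dM dM = 0 by have := coefB 0 0%N; rewrite big_ord1 p0.
have BM w : B dM w = 0.
  have [beta [a pw]] := p1 w; have := coefB beta 1%N.
  rewrite big_ord_recl big_ord1 /= p0 pw /bump /= (Bsym (w + _)) => /two0.
  by rewrite BDr (Bsym dM (a *: _)) BZl BMM mulr0 addr0.
have Bww w : B w w = 0.
  have [beta [a pw]] := p1 w; have := coefB beta 2%N.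
  rewrite !big_ord_recl big_ord0 /= /bump /= p0 BM (Bsym _ dM) BM pw add0r !addr0.
  by rewrite BDl BZl BM mulr0 addr0 BDr (Bsym w (a *: _)) BZl BM mulr0 addr0.
(* Polarization recovers the entries of [C] from [Bww]. *)
apply/matrixP => i j; rewrite mxE -Bdelta; apply: two0.
have := Bww (delta_mx 0 i + delta_mx 0 j).
by rewrite BDl !BDr !Bww add0r addr0 (Bsym (delta_mx 0 j)).
Qed.

(** * The quadratic form in the coordinates of [x] *)

Section QuadraticForm.
Variables (m : nat) (A : 'M[k]_m) (x : 'I_m -> S).

Definition coef_mx : 'M[k]_(n.+1, m) := \matrix_(j, i) coord e j (x i).
(** The Gram matrix of the component vectors x_j of [x]; it vanishes iff their span is totally
    isotropic. *)
Definition coef_gram : 'M[k]_n.+1 := coef_mx *m A *m coef_mx^T.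

Lemma coef_gramE j l :
  coef_gram j l = \sum_i1 \sum_i2 A i1 i2 * (coord e j (x i1) * coord e l (x i2)).
Proof.
rewrite /coef_gram -mulmxA mxE; apply: eq_bigr => i1 _.
rewrite [(_ *m _) _ _]mxE mulr_sumr; apply: eq_bigr => i2 _.
by rewrite !mxE mulrCA.
Qed.

Lemma qform_coef_gram (u : 'I_n.+1 -> k) :
  qform A (fun i => \sum_j coord e j (x i) * u j) = qform coef_gram u.
Proof.
have qformE r (D : 'M[k]_r) v :
    qform D v = ((\row_i v i) *m D *m (\row_i v i)^T) 0 0.
  rewrite -mulmxA mxE; apply: eq_bigr => i _.
  rewrite [(_ *m _) _ _]mxE mulr_sumr; apply: eq_bigr => j _.
  by rewrite !mxE mulrCA mulrA.
rewrite !qformE (_ : \row_i _ = (\row_j u j) *m coef_mx); last first.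
  by apply/rowP => i; rewrite !mxE; apply: eq_bigr => j _; rewrite !mxE mulrC.
by rewrite /coef_gram trmx_mul !mulmxA.
Qed.

Lemma qformS_coef_gram :
  qformS A x = \sum_j \sum_l coef_gram j l *: (c ^+ j * c ^+ l).
Proof.
under [RHS]eq_bigr => j _ do under eq_bigr => l _ do
  rewrite coef_gramE scaler_suml.
under [RHS]eq_bigr => j _ do rewrite exchange_big.
rewrite exchange_big; apply: eq_bigr => i1 _ /=.
under [RHS]eq_bigr => j _ do under eq_bigr => l _ do rewrite scaler_suml.
under [RHS]eq_bigr => j _ do rewrite exchange_big.
rewrite exchange_big; apply: eq_bigr => i2 _ /=.
rewrite {1}(pow_sum (x i1)) {1}(pow_sum (x i2)) mulr_suml scaler_sumr.
apply: eq_bigr => j _; rewrite mulr_sumr scaler_sumr; apply: eq_bigr => l _.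
by rewrite -scalerAl -scalerAr !scalerA mulrA.
Qed.

(** The factor [\det (twisted_mx b)] tests membership in V; on V, Cramer's rule makes the other
    factor the square of this determinant times the value of q on the braces. *)
Lemma Uset_twisted b : b \is a GRing.unit ->
  Uset n.+1 c A x b <->
  \det (twisted_mx b) * qform coef_gram (twisted_cof b) != 0.
Proof.
move=> bu; set d := \det _.
have qdet : Vset n.+1 c b -> qform coef_gram (twisted_cof b) =
    d ^+ 2 * qform A (fun i => brace n.+1 (x i / b) (c * b ^+ 2)).
  move=> Vb; rewrite -qform_coef_gram /qform mulr_sumr; apply: eq_bigr => i _.
  rewrite mulr_sumr; apply: eq_bigr => j _.
  by rewrite -!brace_twisted // -/d expr2 !mulrA [_ * d]mulrC -!mulrA; congr (_ * _);
    rewrite [in LHS]mulrCA; congr (_ * _); rewrite [in LHS]mulrCA.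
split=> [[Vb /eqP q0]|].
  have := Vb; rewrite Vset_twisted // unitmxE unitfE -/d => d0.
  by rewrite qdet // !mulf_neq0.
rewrite mulf_eq0 negb_or => /andP[d0 q0].
have Vb : Vset n.+1 c b by apply/Vset_twisted => //; rewrite unitmxE unitfE.
split=> // qb; case/eqP: q0.
by rewrite qdet // qb mulr0.
Qed.

Lemma Uset_nonempty : [pchar k] =i pred0 -> A^T = A -> qformS A x <> 0 ->
  exists b, Uset n.+1 c A x b.
Proof.
move=> k0 Asym qx; apply: NNPP => Uempty; case: qx.
suff C0 : coef_gram = 0.
  by rewrite qformS_coef_gram C0 !big1 // => j _; rewrite big1 // => l _;
    rewrite mxE scale0r.
apply: isotropic_lines_eq0 => //.
  by rewrite /coef_gram !trmx_mul trmxK Asym mulmxA.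
move=> beta; set Q := \sum_i _.
have Qeval s : Q.[s] = qform coef_gram (twisted_cof (1 + s *: beta)).
  rewrite /Q horner_sum; apply: eq_bigr => i _; rewrite horner_sum.
  by apply: eq_bigr => j _; rewrite !hornerM hornerC !line_cof_eval.
have Deval s : (\det (line_mx beta)).[s] = \det (twisted_mx (1 + s *: beta)).
  by rewrite -line_mx_eval det_map_mx.
have D0 : \det (line_mx beta) != 0.
  apply/eqP => /(congr1 (fun q : {poly k} => q.[0])).
  rewrite Deval scale0r addr0 twisted_mx1 det1 horner0.
  by apply/eqP; rewrite oner_eq0.
apply/eqP; apply: contraT => Q0; case: Uempty.
(* Avoiding the roots of the determinant as well makes [1 + s *: beta] a unit. *)
have [s] := pchar0_poly_nonroot k0 (mulf_neq0 D0 Q0).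
rewrite hornerM Qeval Deval => nz; exists (1 + s *: beta).
apply/Uset_twisted => //; apply: twisted_unit.
by rewrite unitmxE unitfE; apply: contraNneq nz => ->; rewrite mul0r.
Qed.

Lemma Uset_open : open_in_units (Uset n.+1 c A x).
Proof.
split; first by move=> b [[]].
pose M : 'M[{mpoly k[\dim {: S}]}]_n.+1 :=
  \matrix_(i, j) sval (mul_exp_coord_mpoly e j (c ^+ i) i.*2.+1).
have Meval b : map_mx (meval (coords b)) M = twisted_mx b.
  by apply/matrixP => i j; rewrite !mxE; case: mul_exp_coord_mpoly.
pose a j := \adj M j ord_max.
have aeval b j : (a j).@[coords b] = twisted_cof b j.
  by rewrite /twisted_cof -Meval -map_mx_adj mxE.
pose G := \det M * \sum_i \sum_j (coef_gram i j)%:MP * a i * a j.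
have Geval b : G.@[coords b] =
    \det (twisted_mx b) * qform coef_gram (twisted_cof b).
  rewrite mevalM -Meval det_map_mx; congr (_ * _).
  rewrite raddf_sum; apply: eq_bigr => i _; rewrite raddf_sum.
  by apply: eq_bigr => j _; rewrite /= !mevalM mevalC !aeval.
exists (fun b => G.@[coords b] = 0); split.
  exists (eq G) => b; split=> [G0 _ <- //|]; exact.
move=> b bu; rewrite Uset_twisted // Geval.
by split=> [/eqP|/eqP].
Qed.

End QuadraticForm.

End SimpleExtension.

Theorem theorem3p11 (k : fieldType) (S : falgType k) (n : nat) (c : S)
  (m : nat) (A : 'M[k]_m) (x : 'I_m -> S) :
  [pchar k] =i pred0 ->
  primitive_elt n c ->
  regular_qform A ->
  qformS A x <> 0 ->
  (exists b, Uset n c A x b) /\ open_in_units (Uset n c A x).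
Proof.
case: n => [|n] k0 c_prim [Asym _] qx.
  (* In degree 0 the empty family would span [S], forcing 1 = 0. *)
  have [_ /span_basis] := c_prim; rewrite span_nil => f0.
  by have := memvf (1 : S); rewrite -f0 memv0 oner_eq0.
have /primitive_eltP[c_unit c_basis] := c_prim.
by split; [apply: Uset_nonempty | apply: Uset_open].
Qed.
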